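(* Let $p>3$ be a prime and $m\in\{2,3\}$. Then the line graph $L(\Gamma(\mathbb{Z}_{p^m}))$ is pancyclic.
   Context: For a finite commutative ring $R$ with unity, the zero-divisor graph $\Gamma(R)$ has vertex set the nonzero zero-divisors of $R$, with distinct $x,y$ adjacent iff $xy=0$. The line graph $L(G)$ has the edges of $G$ as vertices, two being adjacent iff they share an endpoint in $G$. A graph of order $N$ is pancyclic if $N\ge 3$ and it contains a cycle of length $k$ for every $3\le k\le N$. *)

(* Defs.v *)
From HB Require Import structures.
From mathcomp Require Import all_boot all_order all_algebra.

Set Implicit Arguments.
Unset Strict Implicit.
Unset Printing Implicit Defensive.

Import GRing.Theory.

Record sgraph := SGraph {
  vertex :> finType;
  adj : rel vertex;
  adj_sym : symmetric adj;
  adj_irrefl : irreflexive adj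
}.

Section ZeroDivisorGraph.
Variable R : finComNzRingType.
Local Open Scope ring_scope.

Definition zero_divisor (x : R) : bool := [exists y : R, (y != 0) && (x * y == 0)].

Definition zd_vertex : finType := {x : R | (x != 0) && zero_divisor x}.

Definition zd_adj : rel zd_vertex :=
  [rel x y | (x != y) && (val x * val y == 0)].

Fact zd_adj_sym : symmetric zd_adj.
Proof. by move=> x y; rewrite /zd_adj /= eq_sym mulrC. Qed.

Fact zd_adj_irrefl : irreflexive zd_adj.
Proof. by move=> x; rewrite /zd_adj /= eqxx. Qed.

Definition zd_graph : sgraph := SGraph zd_adj_sym zd_adj_irrefl.
End ZeroDivisorGraph.

Section LineGraph.
Variable G : sgraph.

Definition is_edge (A : {set G}) : bool :=
  [exists x, exists y, adj x y && (A == [set x; y])].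

Definition line_vertex : finType := {A : {set G} | is_edge A}.

Definition line_adj : rel line_vertex :=
  [rel A B | (A != B) && (val A :&: val B != set0)].

Fact line_adj_sym : symmetric line_adj.
Proof. by move=> A B; rewrite /line_adj /= eq_sym setIC. Qed.

Fact line_adj_irrefl : irreflexive line_adj.
Proof. by move=> A; rewrite /line_adj /= eqxx. Qed.

Definition line_graph : sgraph := SGraph line_adj_sym line_adj_irrefl.
End LineGraph.

(* A cycle of length k >= 3 is a duplicate-free closed walk of k vertices;
   [ucycle] alone also accepts sequences of size at most 2. *)
Definition has_cycle (G : sgraph) (k : nat) : Prop :=
  3 <= k /\ exists c : seq G, size c = k /\ ucycle (@adj G) c.

Definition pancyclic (G : sgraph) : Prop :=
  3 <= #|G| /\ forall k : nat, 3 <= k <= #|G| -> has_cycle G k.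

(* Main.v *)
(** If the edges of a graph are all covered by a clique [s] of at least three
    vertices, its line graph is pancyclic.  For [k <= size s] a [k]-cycle inside
    the clique yields a [k]-cycle of edges.  The cycle obtained from the whole
    of [s] has, for every [x] in [s], two consecutive edges meeting at [x]; any
    unused edge contains some [x] of [s] and can be inserted between those two,
    and the enlarged cycle keeps this property.  In [Z_(p^m)], [m = 2, 3], the
    nonzero [x] with [x * p = 0] form such a clique, with [p - 1 >= 3] elements. *)

Require Import Defs.
From HB Require Import structures.
From mathcomp Require Import all_boot all_order all_algebra.
From mathcomp Require Import zify.

Set Implicit Arguments.
Unset Strict Implicit.
Unset Printing Implicit Defensive.

(** This keeps the edges [[set x; next t x]] of a cycle pairwise distinct; on two vertices they
    would coincide. *)
Lemma next_next_neq (T : eqType) (t : seq T) (x : T) :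
  uniq t -> 2 < size t -> x \in t -> next t (next t x) != x.
Proof.
move=> ut st xt; have [i t' def_t] := rot_to xt.
have ur : uniq (rot i t) by rewrite rot_uniq.
rewrite -!(next_rot i ut) def_t.
move: ur st; rewrite -(size_rot i t) def_t.
case: t' {def_t} => [|y [|z t']] //= /andP[].
rewrite !inE !negb_or => /and3P[nxy nxz _] _ _.
by rewrite !eqxx [y == x]eq_sym (negbTE nxy) eq_sym.
Qed.

Section CliqueVertexCover.
Variable G : sgraph.
Implicit Types (e : line_vertex G) (x y : G) (t : seq G).

(* A cycle of edges is represented by pairs (e, x), where x is a vertex that e
   shares with the edge of the following pair. *)
Definition meets_next (a b : line_vertex G * G) : bool :=
  [&& a.1 != b.1, a.2 \in val a.1 & a.2 \in val b.1].

(** Only the edges have to be distinct: labels may repeat, and do so after an insertion. *)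
Definition labelled_cycle (d : seq (line_vertex G * G)) : bool :=
  uniq (unzip1 d) && cycle meets_next d.

Lemma labelled_cycle_ucycle d :
  labelled_cycle d -> ucycle (@adj (line_graph G)) (unzip1 d).
Proof.
case/andP=> ud cd; rewrite /ucycle /ucycleb ud andbT cycle_map.
apply: sub_cycle cd => a b /and3P[nab a1 a2] /=.
by apply/andP; split=> //; apply/set0Pn; exists a.2; rewrite inE a1.
Qed.

Lemma is_edge_pair x y : adj x y -> is_edge [set x; y].
Proof.
by move=> axy; apply/existsP; exists x; apply/existsP; exists y; rewrite axy /=.
Qed.

(** Take the edges [[set x; next t x]], each labelled by [next t x], the vertex it shares with its
    successor. *)
Lemma clique_labelled_cycle t :
    uniq t -> 2 < size t -> {in t &, forall x y, x != y -> adj x y} ->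
  exists d, [/\ labelled_cycle d, size d = size t & {subset t <= unzip2 d}].
Proof.
move=> ut st clique_t.
have next_neq x : x \in t -> next t x != x.
  move=> xt; apply: contraNneq (next_next_neq ut st xt) => nx.
  by rewrite !nx.
have edge_t x : x \in t -> is_edge [set x; next t x].
  by move=> xt; rewrite is_edge_pair // clique_t ?mem_next // eq_sym next_neq.
have [x0 x0t] : exists x, x \in t.
  by case: (t) st => // x t' _; exists x; rewrite mem_head.
pose e0 : line_vertex G := Sub _ (edge_t _ x0t).
pose f x : line_vertex G := insubd e0 [set x; next t x].
have fE x : x \in t -> val (f x) = [set x; next t x].
  by move=> xt; rewrite val_insubd edge_t.
have f_inj : {in t &, injective f}.
  (* Equal edges with [x != y] would force [x = next t y] and [y = next t x], a return after two
     steps. *)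
  move=> x y xt yt /(congr1 val); rewrite !fE // => exy.
  apply/eqP; apply: contraTT isT => nxy.
  have := set21 x (next t x); rewrite exy !inE (negbTE nxy) /= => /eqP xny.
  have := set21 y (next t y); rewrite -exy !inE eq_sym (negbTE nxy) /= => /eqP ynx.
  by have := next_next_neq ut st xt; rewrite -ynx -xny eqxx.
exists [seq (f x, next t x) | x <- t]; split; last first.
- move=> x xt; rewrite /unzip2 -map_comp; apply/mapP.
  by exists (prev t x); rewrite ?mem_prev //= next_prev.
- by rewrite size_map.
rewrite /labelled_cycle /unzip1 -map_comp map_inj_in_uniq //= ut /= cycle_map.
apply: (@sub_in_cycle _ (mem t) _ _ _ _ _ (cycle_next ut)); last exact/allP.
move=> x y xt yt /eqP <- /=.
rewrite /meets_next /= !fE ?mem_next // set22 set21 !andbT.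
apply/eqP => /f_inj; rewrite mem_next => /(_ xt xt) exn.
by have := next_neq x xt; rewrite -exn eqxx.
Qed.

(** If [f] is the edge labelled [x], then [x] lies in both [f] and its successor, so [e] fits
    between them. Labelling [e] by [x] as well loses no label. *)
Lemma labelled_cycle_insert d e x :
    labelled_cycle d -> x \in unzip2 d -> x \in val e -> e \notin unzip1 d ->
  exists d', [/\ labelled_cycle d', size d' = (size d).+1
               & {subset unzip2 d <= unzip2 d'}].
Proof.
move=> /andP[ud cd] /mapP[[f y] fd /= ->{x}] ye eNd.
have [i r def_d] := rot_to fd.
have pd : perm_eq ((f, y) :: r) d by rewrite -def_d perm_rot.
have nef : e \notin f :: unzip1 r.
  by rewrite -[_ :: _]/(unzip1 ((f, y) :: r)) (perm_mem (perm_map fst pd)).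
exists ((f, y) :: (e, y) :: r); split.
- move: ud cd; rewrite -(rot_cycle i) def_d -(perm_uniq (perm_map fst pd)).
  move=> /= /andP[fr ur] pr.
  move: nef; rewrite inE negb_or => /andP[nef er].
  apply/andP; split; first by rewrite /= in_cons negb_or eq_sym nef fr er ur.
  (* The head [b] of [rcons r (f, y)] is what follows [e] in the new cycle, wrapping around to [f]
     if [r] is empty. *)
  have hr : {in rcons r (f, y), forall b, e != b.1}.
    move=> b; rewrite mem_rcons inE => /predU1P[->//|br].
    by apply: contraNneq er => ->; apply: map_f.
  move: pr hr => /=; case def_r: (rcons r _) => [|b r'] /=.
    by case: (r) def_r.
  move=> /andP[/and3P[nfb yf yb] pr'] /(_ b (mem_head _ _)) neb.
  by rewrite /meets_next /= eq_sym nef neb yf ye yb.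
- by rewrite /= -(perm_size pd).
- move=> z; rewrite -(perm_mem (perm_map snd pd)) /= !inE.
  by case/orP=> ->; rewrite ?orbT.
Qed.

Lemma labelled_cycle_extend (s : seq G) d k :
    (forall x y, adj x y -> (x \in s) || (y \in s)) ->
    labelled_cycle d -> {subset s <= unzip2 d} ->
    size d <= k <= #|line_graph G| ->
  exists2 d', labelled_cycle d' & size d' = k.
Proof.
move=> cover_s + + /andP[]; move def_j: (k - size d) => j.
elim: j d def_j => [|j IHj] d def_j ld sd le_dk le_kn.
  by exists d => //; apply/eqP; rewrite eqn_leq le_dk -subn_eq0 def_j.
have /andP[ud _] := ld.
have [e eNd] : exists e, e \notin unzip1 d.
  apply/existsP; rewrite -negb_forall; apply/forallP => all_d.
  have: #|line_graph G| <= size (unzip1 d).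
    by rewrite cardE uniq_leq_size ?enum_uniq // => e _; apply/negPn; rewrite all_d.
  by rewrite size_map; lia.
have [x xs xe] : exists2 x, x \in s & x \in val e.
  have /existsP[x /existsP[y /andP[axy /eqP ->]]] := valP e.
  by case/orP: (cover_s _ _ axy); [exists x | exists y]; rewrite ?set21 ?set22.
have [d' [ld' sz_d' sub_d']] := labelled_cycle_insert ld (sd _ xs) xe eNd.
apply: (IHj d') => //; first by lia.
- by move=> z /sd/sub_d'.
- by lia.
Qed.

Lemma line_graph_pancyclic (s : seq G) :
    uniq s -> 2 < size s -> {in s &, forall x y, x != y -> adj x y} ->
    (forall x y, adj x y -> (x \in s) || (y \in s)) ->
  pancyclic (line_graph G).
Proof.
move=> us ss clique_s cover_s.
(* Prefixes of [s] are cliques too, giving lengths up to [size s]; the full prefix starts the longer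
   cycles. *)
have short k : 2 < k <= size s -> exists d,
    [/\ labelled_cycle d, size d = k & {subset take k s <= unzip2 d}].
  case/andP=> k_gt2 k_le; have sz_t : size (take k s) = k by rewrite size_takel.
  have [||x y /mem_take xs /mem_take ys|d [ld sz_d sd]] :=
    @clique_labelled_cycle (take k s).
  - exact: take_uniq.
  - by rewrite sz_t.
  - exact: clique_s.
  by exists d; rewrite sz_d sz_t.
split=> [|k /andP[k_gt2 k_le]].
  have [|d [/andP[ud _] sz_d _]] := short 3; first by rewrite ss.
  by rewrite -sz_d -(size_map fst) -(card_uniqP ud) max_card.
split=> //.
have [d ld sz_d] : exists2 d, labelled_cycle d & size d = k.
  case: (leqP k (size s)) => [k_les|k_gts].
    by have [|d [ld sz_d _]] := short k; [rewrite k_gt2 | exists d].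
  have [|d [ld sz_d]] := short (size s); first by rewrite ss leqnn.
  rewrite take_size => sd.
  by apply: (labelled_cycle_extend cover_s ld sd); rewrite sz_d ltnW.
by exists (unzip1 d); rewrite size_map; split=> //; apply: labelled_cycle_ucycle.
Qed.

End CliqueVertexCover.

Section ZmodPrimePower.
Variables p m : nat.
Hypotheses (p_prime : prime p) (m_gt1 : 1 < m).
Local Open Scope ring_scope.
Import GRing.Theory.

Lemma Zp_order_gt1 : (1 < p ^ m)%N.
Proof. by rewrite -(exp1n m) ltn_exp2r ?prime_gt1 // ltnW. Qed.

Lemma prime_lt_expn : (p < p ^ m)%N.
Proof. by rewrite -{1}(expn1 p) ltn_exp2l // prime_gt1. Qed.

Lemma Zp_mul_eq0 (x y : 'Z_(p ^ m)) : (x * y == 0) = (p ^ m %| x * y)%N.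
Proof.
rewrite -val_eqE /= /dvdn; congr (_ %% _ == _)%N.
exact: Zp_cast Zp_order_gt1.
Qed.

Lemma Zp_mulp_eq0 (x : 'Z_(p ^ m)) :
  (x * p%:R == 0) = (p ^ m.-1 %| x)%N.
Proof.
have p_gt0 := prime_gt0 p_prime.
rewrite Zp_mul_eq0 (val_Zp_nat Zp_order_gt1).
rewrite modn_small ?prime_lt_expn //.
by rewrite -{1}(ltn_predK m_gt1) expnSr dvdn_pmul2r.
Qed.

(** If both fail, the [p]-adic valuations of [x] and [y] are at most [m - 2], so their sum is at
    most [2m - 4 < m]. This is the covering condition. *)
Lemma Zp_mul_eq0_mulp (x y : 'Z_(p ^ m)) : (m <= 3)%N ->
  x != 0 -> y != 0 -> x * y = 0 -> (x * p%:R == 0) || (y * p%:R == 0).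
Proof.
move=> m_le3 x0 y0 /eqP; rewrite Zp_mul_eq0 !Zp_mulp_eq0.
have gt0 (z : 'Z_(p ^ m)) : z != 0 -> (0 < z)%N by rewrite lt0n.
rewrite !pfactor_dvdn ?muln_gt0 ?gt0 // lognM ?gt0 //.
by lia.
Qed.

(** Both are multiples of [p ^ m.-1], and [2(m - 1) >= m]. This is the clique condition. *)
Lemma Zp_mulp_eq0_mul (x y : 'Z_(p ^ m)) :
  x * p%:R == 0 -> y * p%:R == 0 -> x * y == 0.
Proof.
rewrite !Zp_mulp_eq0 Zp_mul_eq0 => xp yp.
by apply: dvdn_trans (dvdn_mul xp yp); rewrite -expnD dvdn_exp2l //; lia.
Qed.

End ZmodPrimePower.

Theorem theorem3p4 (p m : nat) (p_prime : prime p) (p_gt3 : 3 < p)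
    (m23 : m = 2 \/ m = 3) :
  pancyclic (line_graph (zd_graph 'Z_(p ^ m))).
Proof.
have m_gt1 : 1 < m by case: m23 => ->.
have m_le3 : m <= 3 by case: m23 => ->.
have q_gt1 := Zp_order_gt1 p_prime m_gt1.
have p_neq0 : (p%:R != 0 :> 'Z_(p ^ m))%R.
  rewrite -val_eqE /= (val_Zp_nat q_gt1) modn_small ?prime_lt_expn //.
  by rewrite -lt0n prime_gt0.
pose ann : pred (zd_graph 'Z_(p ^ m)) := [pred x | val x * p%:R == 0]%R.
apply: (@line_graph_pancyclic _ (enum ann)).
- exact: enum_uniq.
(* Three annihilated vertices suffice: [a 1], [a 2], [a 3], nonzero and distinct since [p > 3]. *)
- pose a j : 'Z_(p ^ m) := ((j * p ^ m.-1)%N%:R)%R.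
  have aE j : j < p -> a j = j * p ^ m.-1 :> nat.
    move=> j_lt; rewrite (val_Zp_nat q_gt1) modn_small //.
    by rewrite -{2}(ltn_predK m_gt1) expnS ltn_pmul2r // expn_gt0 prime_gt0.
  have ap0 j : j < p -> (a j * p%:R == 0)%R.
    by move=> j_lt; rewrite Zp_mulp_eq0 // aE // dvdn_mull.
  have a_vertex j : 0 < j < p -> (a j != 0)%R && zero_divisor (a j).
    case/andP=> j_gt0 j_lt; apply/andP; split.
      by rewrite -val_eqE /= aE // -lt0n muln_gt0 j_gt0 expn_gt0 prime_gt0.
    by apply/existsP; exists (p%:R)%R; rewrite p_neq0 ap0.
  have lt1 : 0 < 1 < p by lia.
  have lt2 : 0 < 2 < p by lia.
  have lt3 : 0 < 3 < p by lia.
  pose v j (lt_j : 0 < j < p) : zd_graph 'Z_(p ^ m) := Sub (a j) (a_vertex j lt_j).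
  have: uniq [:: v _ lt1; v _ lt2; v _ lt3].
    have pm_gt0 : 0 < p ^ m.-1 by rewrite expn_gt0 prime_gt0.
    apply: (@map_uniq _ _ (fun x => nat_of_ord (val x))).
    by rewrite /= !inE !aE ?eqn_pmul2r //; lia.
  move/uniq_leq_size; apply => x; rewrite !inE mem_enum.
  by case/or3P=> /eqP -> /=; rewrite inE /= ap0 //; lia.
- move=> x y; rewrite !mem_enum !inE => xp yp nxy.
  apply/andP; split=> //.
  exact: Zp_mulp_eq0_mul.
- move=> x y /andP[_ /eqP xy0]; rewrite !mem_enum !inE.
  have /andP[x0 _] := valP x; have /andP[y0 _] := valP y.
  exact: Zp_mul_eq0_mulp.
Qed.
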